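(* Let $X$ and $Y$ be Banach spaces, let $N$ be an absolute normalized norm on $\mathbb R^2$, and let $\Gamma>0$ be such that $N(\cdot)\leq\Gamma\|\cdot\|_\infty$. If $(1,0)$ or $(0,1)$ is an extreme point of $B_{(\mathbb R^2,N)}$, then $\mathcal T^s(X\oplus_NY)\leq\Gamma$. In particular, $\mathcal T^s(X\oplus_pY)\leq2^{1/p}$ whenever $1<p<\infty$.
   Context: All Banach spaces are nontrivial and real. $B_X$ and $S_X$ denote the closed unit ball and the unit sphere of $X$, $X^*$ is the dual, and $B(x,r)$ is the ball with center $x$ and radius $r$. A norm $N$ on $\mathbb R^2$ is absolute if $N(a,b)=N(|a|,|b|)$ for all $(a,b)\in\mathbb R^2$, and normalized if $N(1,0)=N(0,1)=1$. $X\oplus_N Y$ is $X\times Y$ with the norm $\|(x,y)\|_N=N(\|x\|,\|y\|)$; it is written $X\oplus_pY$ when $N$ is the $\ell_p$-norm $\|\cdot\|_p$. A slice of $B_X$ is a set $S(B_X,x^*,\alpha)=\{x\in B_X: x^*(x)>1-\alpha\}$ with $x^*\in S_{X^*}$ and $\alpha>0$. $\mathcal T^s(X)=\inf\{r>0:$ there exist $x\in S_X$ and a slice $S$ of $B_X$ such that $S\subset B(x,r)\}$. *)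

(* Defs.v *)
From HB Require Import structures.
From mathcomp Require Import all_boot all_order all_algebra.
From mathcomp Require Import all_classical all_reals all_analysis.
From mathcomp Require Import lra.

Set Implicit Arguments.
Unset Strict Implicit.
Unset Printing Implicit Defensive.

Import Order.TTheory GRing.Theory Num.Theory.
Import numFieldNormedType.Exports.

Local Open Scope classical_set_scope.
Local Open Scope ring_scope.

Definition unit_ball (R : realType) (X : normedModType R) : set X :=
  [set x | `|x| <= 1].
Arguments unit_ball {R} X.

Definition unit_sphere (R : realType) (X : normedModType R) : set X :=
  [set x | `|x| = 1].
Arguments unit_sphere {R} X.

(* Valued in [\bar R]; it is finite exactly when [f] is continuous. *)
Definition dual_norm (R : realType) (X : normedModType R)
    (f : {linear X -> R^o}) : \bar R :=
  ereal_sup [set (`|f x|)%:E | x in unit_ball X].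

Definition dual_sphere (R : realType) (X : normedModType R) :
    set {linear X -> R^o} :=
  [set f : {linear X -> R^o} | continuous f /\ dual_norm f = 1%E].
Arguments dual_sphere {R} X.

Definition slice (R : realType) (X : normedModType R)
    (f : {linear X -> R^o}) (alpha : R) : set X :=
  [set x | unit_ball X x /\ 1 - alpha < f x].

Definition is_slice (R : realType) (X : normedModType R) (S : set X) : Prop :=
  exists (f : {linear X -> R^o}) (alpha : R),
    [/\ dual_sphere X f, 0 < alpha & S = slice f alpha].

(* The infimum is taken in [\bar R], so that it is [+oo] (and not a default
   real number) if there is no admissible radius. *)
Definition Ts (R : realType) (X : normedModType R) : \bar R :=
  ereal_inf [set r%:E | r in [set r : R | 0 < r /\
    exists (x : X) (S : set X),
      [/\ unit_sphere X x, is_slice S & S `<=` closed_ball x r]]].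

Definition extreme_point (R : realType) (E : lmodType R) (A : set E) (e : E) :
    Prop :=
  A e /\ forall (a b : E) (t : R), A a -> A b -> 0 < t < 1 ->
    e = t *: a + (1 - t) *: b -> a = e /\ b = e.

Record absNorm (R : realType) := AbsNorm {
  absnorm :> R^o * R^o -> R ;
  absnormD : forall u v, absnorm (u + v) <= absnorm u + absnorm v ;
  absnormZ : forall (l : R) v, absnorm (l *: v) = `|l| * absnorm v ;
  absnorm0_eq0 : forall v, absnorm v = 0 -> v = 0 ;
  absnorm_abs : forall a b, absnorm (a, b) = absnorm (`|a|, `|b|) ;
  absnorm10 : absnorm (1, 0) = 1 ;
  absnorm01 : absnorm (0, 1) = 1 }.

Section absNorm_theory.
Context (R : realType) (N : absNorm R).
Implicit Types a b : R.

Lemma absnormN v : N (- v) = N v.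
Proof. by rewrite -scaleN1r absnormZ normrN1 mul1r. Qed.

Lemma absnorm0 : N 0 = 0.
Proof. by rewrite -(scale0r (0 : R^o * R^o)) absnormZ normr0 mul0r. Qed.

Lemma absnorm_ge0 v : 0 <= N v.
Proof.
have := absnormD N v (- v); rewrite subrr absnorm0 absnormN => h; lra.
Qed.

Lemma absnorm_convex (t : R) u v : 0 <= t <= 1 ->
  N (t *: u + (1 - t) *: v) <= t * N u + (1 - t) * N v.
Proof.
move=> /andP[t0 t1]; apply: (le_trans (absnormD _ _ _)).
by rewrite !absnormZ !ger0_norm// subr_ge0.
Qed.

Lemma absnorm_le1 a a' b : 0 <= a -> a <= a' -> N (a, b) <= N (a', b).
Proof.
move=> a0 aa'; have [a'0|a'0] := eqVneq a' 0.
  by rewrite (_ : a = a')//; apply/le_anti; rewrite aa' a'0.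
have a'p : 0 < a' by rewrite lt_neqAle eq_sym a'0 (le_trans a0).
pose t := (1 + a / a') / 2.
have t01 : 0 <= t <= 1.
  have q0 : 0 <= a / a' by rewrite divr_ge0// ltW.
  have q1 : a / a' <= 1 by rewrite ler_pdivrMr// mul1r.
  by apply/andP; split; rewrite /t; lra.
have -> : (a, b) = t *: ((a', b) : R^o * R^o) + (1 - t) *: (- a', b).
  congr pair => /=; rewrite /GRing.scale/=.
    rewrite mulrN -mulNr -mulrDl (_ : t + - (1 - t) = a / a') ?divfK//.
    by rewrite /t; lra.
  by rewrite -mulrDl subrKC mul1r.
apply: (le_trans (absnorm_convex _ _ t01)).
rewrite (absnorm_abs N (- a')) normrN -absnorm_abs -mulrDl subrKC mul1r//.
Qed.

Lemma absnorm_swap : exists M : absNorm R, forall a b, M (a, b) = N (b, a).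
Proof.
unshelve eexists.
  unshelve refine (@AbsNorm R (fun v => N (v.2, v.1)) _ _ _ _ _ _).
  - by move=> u v; exact: (absnormD N (u.2, u.1) (v.2, v.1)).
  - by move=> l v; exact: (absnormZ N l (v.2, v.1)).
  - by move=> [x y] /= /absnorm0_eq0 [-> ->].
  - by move=> a b /=; exact: absnorm_abs.
  - exact: absnorm01.
  - exact: absnorm10.
by [].
Qed.

End absNorm_theory.

Section absNorm_theory2.
Context (R : realType) (N : absNorm R).
Implicit Types a b : R.

Lemma absnorm_le2 a b b' : 0 <= b -> b <= b' -> N (a, b) <= N (a, b').
Proof.
by have [M MN] := absnorm_swap N; rewrite -!MN; exact: absnorm_le1.
Qed.

Lemma absnorm_le a a' b b' : 0 <= a -> a <= a' -> 0 <= b -> b <= b' ->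
  N (a, b) <= N (a', b').
Proof.
move=> a0 aa' b0 bb'; apply: (@le_trans _ _ (N (a', b))).
  exact: absnorm_le1.
exact: absnorm_le2.
Qed.

Lemma absnorm_a0 a : N (a, 0) = `|a|.
Proof.
have -> : (a, 0) = a *: ((1, 0) : R^o * R^o).
  by congr pair; rewrite /GRing.scale/= ?mulr1 ?mulr0.
by rewrite absnormZ absnorm10 mulr1.
Qed.

Lemma absnorm_0b b : N (0, b) = `|b|.
Proof.
have -> : (0, b) = b *: ((0, 1) : R^o * R^o).
  by congr pair; rewrite /GRing.scale/= ?mulr1 ?mulr0.
by rewrite absnormZ absnorm01 mulr1.
Qed.

Lemma absnorm_ge_l a b : 0 <= a -> 0 <= b -> a <= N (a, b).
Proof.
by move=> a0 b0; rewrite -{1}(ger0_norm a0) -absnorm_a0; exact: absnorm_le.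
Qed.

Lemma absnorm_ge_r a b : 0 <= a -> 0 <= b -> b <= N (a, b).
Proof.
by move=> a0 b0; rewrite -{1}(ger0_norm b0) -absnorm_0b; exact: absnorm_le.
Qed.

Lemma absnorm_leD a b : 0 <= a -> 0 <= b -> N (a, b) <= a + b.
Proof.
move=> a0 b0; have -> : (a, b) = (a, 0) + (0, b) :> R^o * R^o.
  by congr pair; rewrite /= ?addr0 ?add0r.
by rewrite (le_trans (absnormD _ _ _))// absnorm_a0 absnorm_0b !ger0_norm.
Qed.

End absNorm_theory2.

(* The space $X \oplus_N Y$: an alias of [X * Y], needed because [X * Y]
   itself canonically carries the maximum norm. *)
Definition abs_sum (R : realType) (N : absNorm R) (X Y : normedModType R) :
  Type := (X * Y)%type.

Section abs_sum_normed.
Context (R : realType) (N : absNorm R) (X Y : normedModType R).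
Local Notation XY := (abs_sum N X Y).

HB.instance Definition _ := GRing.Lmodule.copy XY (X * Y)%type.

Definition abs_sum_norm (z : XY) : R := N (`|z.1|, `|z.2|).

Let abs_sum_normD (z w : XY) :
  abs_sum_norm (z + w) <= abs_sum_norm z + abs_sum_norm w.
Proof.
apply: (le_trans _ (absnormD N (`|z.1|, `|z.2|) (`|w.1|, `|w.2|))).
by apply: absnorm_le; rewrite ?normr_ge0//; exact: ler_normD.
Qed.

Let abs_sum_normZ (l : R) (z : XY) :
  abs_sum_norm (l *: z) = `|l| * abs_sum_norm z.
Proof.
rewrite /abs_sum_norm/= !normrZ -{3}(normr_id l) -absnormZ; congr (N _).
Qed.

Let abs_sum_norm0_eq0 (z : XY) : abs_sum_norm z = 0 -> z = 0.
Proof.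
by case: z => x y /absnorm0_eq0 [/normr0_eq0 -> /normr0_eq0 ->].
Qed.

HB.instance Definition _ := @Lmodule_isNormed.Build R XY abs_sum_norm
  abs_sum_normD abs_sum_normZ abs_sum_norm0_eq0.

Lemma abs_sum_normE (z : XY) : `|z| = N (`|z.1|, `|z.2|).
Proof. by []. Qed.

End abs_sum_normed.

Section abs_sum_complete.
Context (R : realType) (N : absNorm R) (X Y : completeNormedModType R).
Local Notation XY := (abs_sum N X Y).

Let fst_le (z : XY) : `|z.1| <= `|z|.
Proof. by rewrite abs_sum_normE absnorm_ge_l. Qed.

Let snd_le (z : XY) : `|z.2| <= `|z|.
Proof. by rewrite abs_sum_normE absnorm_ge_r. Qed.

Let abs_sum_complete (F : set_system XY) :
  ProperFilter F -> cauchy F -> cvg F.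
Proof.
move=> FF Fc.
pose f1 (z : XY) : X := z.1; pose f2 (z : XY) : Y := z.2.
have c1 : cauchy (f1 @ F).
  apply/cauchyP => e e0; move/cauchyP: Fc => /(_ e e0) [z Fz].
  exists (f1 z); rewrite /fmap/=; apply: filterS Fz => w.
  rewrite -!ball_normE/= => zw; exact: (le_lt_trans (fst_le (z - w))).
have c2 : cauchy (f2 @ F).
  apply/cauchyP => e e0; move/cauchyP: Fc => /(_ e e0) [z Fz].
  exists (f2 z); rewrite /fmap/=; apply: filterS Fz => w.
  rewrite -!ball_normE/= => zw; exact: (le_lt_trans (snd_le (z - w))).
have cv1 : cvg (f1 @ F) by exact: (cauchy_cvg _ c1).
have [x /cvgrPdist_lt xF] := (cvg_ex (f1 @ F)).1 cv1.
have cv2 : cvg (f2 @ F) by exact: (cauchy_cvg _ c2).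
have [y /cvgrPdist_lt yF] := (cvg_ex (f2 @ F)).1 cv2.
apply/cvg_ex; exists ((x, y) : XY); apply/cvgrPdist_lt => e e0.
have e20 : 0 < e / 2 by rewrite divr_gt0.
have Fx := xF _ e20; have Fy := yF _ e20.
near=> z.
have hx : `|x - z.1| < e / 2 by near: z.
have hy : `|y - z.2| < e / 2 by near: z.
rewrite abs_sum_normE /= (le_lt_trans (absnorm_leD _ _ _))//.
by rewrite (splitr e) ltrD.
Unshelve. all: by end_near. Qed.

HB.instance Definition _ := Uniform_isComplete.Build XY abs_sum_complete.

End abs_sum_complete.

Section lp_norm.
Context (R : realType) (p : R) (p1 : 1 <= p).

Definition lp_fun (v : R^o * R^o) : R :=
  (`|v.1| `^ p + `|v.2| `^ p) `^ p^-1.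

Let p0 : 0 < p. Proof. exact: lt_le_trans p1. Qed.

Let lp_funD u v : lp_fun (u + v) <= lp_fun u + lp_fun v.
Proof.
pose f (w : R^o * R^o) n : R := match n with 0%N => w.1 | 1%N => w.2 | _ => 0 end.
have mf w : measurable_fun setT (f w) by [].
have L w : Lnorm counting p%:E (EFin \o f w) = (lp_fun w)%:E.
  rewrite Lnorm_counting//.
  rewrite (nneseries_split 0 2); last by move=> k _; rewrite lee_fin powR_ge0.
  rewrite ereal_series_cond eseries0 ?adde0; last first.
    by move=> [//|] [//|n _]; rewrite /f /= normr0 powR0// gt_eqF.
  by rewrite add0n big_mkord 2!big_ord_recr /= big_ord0 add0e -EFinD poweR_EFin.
have := minkowski_EFin counting (mf u) (mf v) p1.
rewrite (_ : (f u \+ f v)%R = f (u + v)) ?L -?EFinD ?lee_fin//.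
by apply/funext => -[|[|n]] //=; rewrite addr0.
Qed.

Let lp_funZ (l : R) v : lp_fun (l *: v) = `|l| * lp_fun v.
Proof.
rewrite /lp_fun/= /GRing.scale/= !normrM !powRM// -mulrDr powRM ?powR_ge0//.
  by rewrite -powRrM mulfV ?powRr1// gt_eqF.
Qed.

Let lp_fun0_eq0 v : lp_fun v = 0 -> v = 0.
Proof.
case: v => a b /powR_eq0_eq0 /eqP.
rewrite paddr_eq0 ?powR_ge0//= => /andP[/eqP/powR_eq0_eq0 + /eqP/powR_eq0_eq0].
by move=> /normr0_eq0 -> /normr0_eq0 ->.
Qed.

Let lp_fun_abs a b : lp_fun (a, b) = lp_fun (`|a|, `|b|).
Proof. by rewrite /lp_fun/= !normr_id. Qed.

Let lp_fun10 : lp_fun (1, 0) = 1.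
Proof. by rewrite /lp_fun/= normr0 normr1 powR0 ?gt_eqF// addr0 !powR1. Qed.

Let lp_fun01 : lp_fun (0, 1) = 1.
Proof. by rewrite /lp_fun/= normr0 normr1 powR0 ?gt_eqF// add0r !powR1. Qed.

Definition lp_norm : absNorm R :=
  AbsNorm lp_funD lp_funZ lp_fun0_eq0 lp_fun_abs lp_fun10 lp_fun01.

End lp_norm.

(* Main.v *)
(* If (1,0) is an extreme point, then N(1,e) > 1 for every e > 0, so a slice of
   the unit ball given by a functional (x,y) |-> f(x), with f a norm-one
   functional attaining its norm, only contains points (x,y) with |y| < e as
   soon as the slice is thin enough. Such a slice lies in the ball of radius
   N(1,1+e) <= Gamma (1+e) around (0,y0), for any unit vector y0. The functional
   f comes from the Hahn-Banach theorem, proved by showing that the minimal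
   elements among the sublinear functionals on the whole space are linear; this
   avoids functionals defined on subspaces. *)
Require Import Defs.
From HB Require Import structures.
From mathcomp Require Import all_boot all_order all_algebra.
From mathcomp Require Import all_classical all_reals all_analysis.
From mathcomp Require Import lra.

Set Implicit Arguments.
Unset Strict Implicit.
Unset Printing Implicit Defensive.

Import Order.TTheory GRing.Theory Num.Theory.
Import numFieldNormedType.Exports.

Local Open Scope classical_set_scope.
Local Open Scope ring_scope.

(** * Sublinear functionals, the Hahn-Banach theorem and norming functionals *)

Definition sublinear (R : realType) (V : lmodType R) (p : V -> R) : Prop :=
  (forall x y, p (x + y) <= p x + p y) /\
  (forall s x, 0 <= s -> p (s *: x) <= s * p x).

Section sublinear.
Context (R : realType) (V : lmodType R).
Implicit Types (p q : V -> R) (x y : V).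

Lemma sublinear0 p : sublinear p -> p 0 = 0.
Proof.
move=> [pD pZ]; have := pD 0 0; have := pZ 0 0 (lexx 0).
by rewrite scale0r addr0; lra.
Qed.

Lemma sublinearN p x : sublinear p -> - p (- x) <= p x.
Proof.
move=> sp; have := sp.1 x (- x).
by rewrite subrr sublinear0 //; lra.
Qed.

(** The index [k] need only do as well as [i] and [j] together: it is a sum of parameters for tilts
    and the smaller of two functionals for chains. *)
Lemma inf_sublinear (I : Type) (D : set I) (F : I -> V -> R) :
  D !=set0 ->
  (forall x, has_lbound [set F i x | i in D]) ->
  (forall i j x y, D i -> D j ->
     exists2 k, D k & F k (x + y) <= F i x + F j y) ->
  (forall i s x, D i -> 0 <= s -> exists2 k, D k & F k (s *: x) <= s * F i x) ->
  sublinear (fun x => inf [set F i x | i in D]).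
Proof.
move=> D0 lbF FD FZ.
have ne x : [set F i x | i in D] !=set0.
  by have [i Di] := D0; exists (F i x), i.
have infle i x : D i -> inf [set F i x | i in D] <= F i x.
  by move=> Di; apply: ge_inf => //; exists i.
split=> [x y|s x s0].
  rewrite -lerBlDr; apply: lb_le_inf => // _ [i Di <-].
  rewrite lerBlDr -lerBlDl; apply: lb_le_inf => // _ [j Dj <-].
  have [k Dk Fk] := FD i j x y Di Dj.
  by rewrite lerBlDl; exact: le_trans (infle k _ Dk) Fk.
have [->|sn0] := eqVneq s 0.
  have [i Di] := D0; have [k Dk] := FZ i 0 x Di (lexx 0).
  by rewrite !mul0r; exact: le_trans (infle k _ Dk).
rewrite -ler_pdivrMl; last by rewrite lt_neqAle eq_sym sn0.
apply: lb_le_inf => // _ [i Di <-].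
rewrite ler_pdivrMl; last by rewrite lt_neqAle eq_sym sn0.
have [k Dk Fk] := FZ i s x Di s0; exact: le_trans (infle k _ Dk) Fk.
Qed.

(* A sublinear functional below [p] (take [t = 0]) whose value at [- y] is at
   most [- p y] (take [t = 1]); a minimal [p] equals all its tilts, hence is
   odd. *)
Definition tilt p y x : R :=
  inf [set p (x + t *: y) - t * p y | t in [set t | 0 <= t]].

Lemma tilt_lbound p y x : sublinear p ->
  lbound [set p (x + t *: y) - t * p y | t in [set t | 0 <= t]] (- p (- x)).
Proof.
move=> sp _ [t /= t0 <-].
have [t00|tn0] := eqVneq t 0.
  by rewrite t00 scale0r addr0 mul0r subr0 sublinearN.
have tp : 0 < t by rewrite lt_neqAle eq_sym tn0.
have ti : 0 <= t^-1 by rewrite invr_ge0.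
(* Homogeneity is only an inequality; used with the factor [t^-1] it gives the reverse bound
   [t * p y <= p (t *: y)]. *)
have := sp.2 t^-1 (t *: y) ti.
rewrite scalerA mulVf// scale1r ler_pdivlMl//.
by have := sp.1 (x + t *: y) (- x); rewrite addrAC subrr add0r; lra.
Qed.

Lemma tilt_le p y x (t : R) : sublinear p -> 0 <= t ->
  tilt p y x <= p (x + t *: y) - t * p y.
Proof.
move=> sp t0; apply: ge_inf; last by exists t.
by exists (- p (- x)); exact: tilt_lbound.
Qed.

Lemma tilt_le_id p y x : sublinear p -> tilt p y x <= p x.
Proof.
by move=> sp; have := tilt_le y x sp (lexx 0); rewrite scale0r addr0 mul0r subr0.
Qed.

Lemma tilt_opp p y : sublinear p -> tilt p y (- y) <= - p y.
Proof.
move=> sp; have := tilt_le y (- y) sp ler01.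
by rewrite scale1r addNr sublinear0// mul1r sub0r.
Qed.

Lemma tilt_sublinear p y : sublinear p -> sublinear (tilt p y).
Proof.
move=> sp; apply: inf_sublinear.
- by exists 0 => /=.
- by move=> x; exists (- p (- x)); exact: tilt_lbound.
- move=> s t x z /= s0 t0; exists (s + t); first exact: addr_ge0.
  have := sp.1 (x + s *: y) (z + t *: y).
  by rewrite scalerDl addrACA; lra.
- move=> t s x /= t0 s0; exists (s * t); first exact: mulr_ge0.
  have := sp.2 s (x + t *: y) s0.
  by rewrite scalerDr scalerA; lra.
Qed.

(** Comparing [p] with its tilt at [x] gives [p (- x) <= - p x]. Oddness then reverses subadditivity
    and extends homogeneity to negative scalars. *)
Lemma sublinear_minimal_linear p : sublinear p ->
  (forall q, sublinear q -> (forall x, q x <= p x) -> forall x, p x <= q x) ->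
  exists f : {linear V -> R^o}, forall x, f x = p x.
Proof.
move=> sp pmin.
have pN x : p (- x) = - p x.
  apply/le_anti/andP; split; last by have := sublinearN x sp; lra.
  apply: le_trans (tilt_opp x sp).
  by apply: pmin; [exact: tilt_sublinear|move=> z; exact: tilt_le_id].
have pD x y : p (x + y) = p x + p y.
  apply/le_anti; rewrite sp.1 /=.
  by have := sp.1 (x + y) (- y); rewrite addrK pN; lra.
have pZp (s : R) x : 0 < s -> p (s *: x) = s * p x.
  move=> s0; apply/le_anti; rewrite (sp.2 s x (ltW s0)) /=.
  have si : 0 <= s^-1 by rewrite invr_ge0 ltW.
  have := sp.2 s^-1 (s *: x) si.
  by rewrite scalerA mulVf ?gt_eqF// scale1r ler_pdivlMl.
have pZ (s : R) x : p (s *: x) = s * p x.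
  have [s0|s0|->] := ltgtP s 0.
  - have := pZp (- s) x.
    by rewrite scaleNr pN oppr_gt0 mulNr => /(_ s0) /oppr_inj.
  - exact: pZp.
  - by rewrite scale0r mul0r sublinear0.
have plin : linear (p : V -> R^o) by move=> s x y; rewrite pD pZ.
pose pL := GRing.isLinear.Build R V R^o _ (p : V -> R^o) plin.
by exists (HB.pack (p : V -> R^o) pL : {linear V -> R^o}).
Qed.

Lemma hahn_banach_sublinear p : sublinear p ->
  exists f : {linear V -> R^o}, forall x, f x <= p x.
Proof.
move=> sp.
pose T := {q : V -> R | sublinear q /\ forall x, q x <= p x}.
(* The order is reversed, so that a maximal element for [r] is a minimal sublinear functional. *)
pose r (s t : T) := `[< forall x, sval t x <= sval s x >].
have rxx t : r t t by apply/asboolP.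
have rtr s t u : r s t -> r t u -> r s u.
  by move=> /asboolP st /asboolP tu; apply/asboolP => x; exact: le_trans (st x).
have pT : sublinear p /\ forall x, p x <= p x by split.
have [A Atot|[q [sq qp]] qmax] := ZL_preorder (exist _ p pT : T) rxx rtr.
  (* The empty chain is bounded by [p] itself; a pointwise infimum over it would be a default
     value. *)
  have [->|/set0P A0] := eqVneq A set0; first by exists (exist _ p pT).
  pose m x := inf [set sval t x | t in A].
  have lb x : lbound [set sval t x | t in A] (- p (- x)).
    move=> _ [[q [sq qp]] _ <-] /=.
    by apply: le_trans (sublinearN x sq); rewrite lerN2.
  have sm : sublinear m.
    apply: inf_sublinear => //.
    - by move=> x; exists (- p (- x)).
    - move=> s t x y As At.
      have [/asboolP st|/asboolP ts] := Atot s t As At.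
      + exists t => //; apply: le_trans ((svalP t).1.1 x y) _.
        by rewrite lerD2r.
      + exists s => //; apply: le_trans ((svalP s).1.1 x y) _.
        by rewrite lerD2l.
    - by move=> t s x At s0; exists t => //; exact: (svalP t).1.2.
  have mle t x : A t -> m x <= sval t x.
    by move=> At; apply: ge_inf; [exists (- p (- x))|exists t].
  have mp x : m x <= p x.
    by have [t At] := A0; apply: le_trans (mle t x At) _; exact: (svalP t).2.
  by exists (exist _ m (conj sm mp)) => t At; apply/asboolP => x; exact: mle.
have [|f fE] := sublinear_minimal_linear sq; last by exists f => x; rewrite fE.
move=> q' sq' q'q.
have q'p x : q' x <= p x := le_trans (q'q x) (qp x).
by have /asboolP := qmax (exist _ q' (conj sq' q'p)) (asboolT q'q).
Qed.

End sublinear.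

(** Hahn-Banach is applied to the tilt of the norm at [x0], not to the norm itself: a linear [f]
    below the tilt has [f (- x0) <= - |x0|], which forces equality at [x0]. *)
Lemma norming_functional (R : realType) (V : normedModType R) (x0 : V) :
  exists f : {linear V -> R^o}, (forall x, `|f x| <= `|x|) /\ f x0 = `|x0|.
Proof.
have sn : sublinear (fun x : V => `|x|).
  by split=> [|s x s0]; [exact: ler_normD|rewrite normrZ ger0_norm].
have [f fle] := hahn_banach_sublinear (tilt_sublinear x0 sn).
have fle1 x : f x <= `|x| := le_trans (fle x) (tilt_le_id x0 x sn).
exists f; split.
  by move=> x; rewrite ler_norml fle1 lerNl -linearN/= -(normrN x) fle1.
apply/le_anti; rewrite fle1/=.
by have := le_trans (fle (- x0)) (tilt_opp x0 sn); rewrite linearN lerN2.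
Qed.

Lemma norming_dual_sphere (R : realType) (Z : normedModType R)
    (f : {linear Z -> R^o}) (z : Z) :
  (forall x, `|f x| <= `|x|) -> `|z| = 1 -> f z = 1 -> dual_sphere Z f.
Proof.
move=> fle z1 fz1; split.
  apply: bounded_linear_continuous; apply/linear_boundedP.
  near=> r => x; apply: le_trans (fle x) _.
  by rewrite ler_peMl//; near: r; exact: nbhs_pinfty_ge.
apply/le_anti/andP; split.
  by apply: ge_ereal_sup => _ [x /= x1 <-]; rewrite lee_fin (le_trans (fle x)).
by apply: ereal_sup_ubound; exists z; rewrite /unit_ball/= ?z1// fz1 normr1.
Unshelve. all: by end_near. Qed.

(** * Thin slices when (1,0) is an extreme point *)

(** The points (1,e) and (1,-e) have the same norm and midpoint (1,0); if they lay in the ball,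
    extremality would give e = 0. *)
Lemma extreme10_absnorm_gt1 (R : realType) (N : absNorm R) (e : R) :
  extreme_point [set v | N v <= 1] (1, 0) -> 0 < e -> 1 < N (1, e).
Proof.
move=> [_ ext] e0; rewrite ltNge; apply/negP => Ne.
have Ne' : N (1, - e) <= 1 by rewrite absnorm_abs normrN -absnorm_abs.
have half01 : 0 < (2^-1 : R) < 1 by lra.
have [|[e00] _] := ext (1, e) (1, - e) 2^-1 Ne Ne' half01.
  by congr pair => /=; rewrite /GRing.scale/=; lra.
by move: e0; rewrite e00 ltxx.
Qed.

(* The threshold [2 - N (1, e)] on [a] comes from
   [N (1, e) <= N (a, e) + N (1 - a, 0) <= 1 + (1 - a)]. *)
Lemma absnorm_snd_lt (R : realType) (N : absNorm R) (e a b : R) :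
  0 <= a -> 0 <= b -> 0 <= e -> N (a, b) <= 1 -> 2 - N (1, e) < a -> b < e.
Proof.
move=> a0 b0 e0 Nab ae; rewrite ltNge; apply/negP => eb.
have a1 : a <= 1 := le_trans (absnorm_ge_l N a0 b0) Nab.
have Nae : N (a, e) <= 1 by apply: le_trans Nab; exact: absnorm_le2.
have := absnormD N (a, e) (1 - a, 0).
rewrite absnorm_a0 ger0_norm ?subr_ge0//.
have -> : (a, e) + (1 - a, 0) = (1, e) :> R^o * R^o.
  by congr pair => /=; rewrite ?addr0// subrKC.
by lra.
Qed.

(* Stated for abstract coordinate maps so that it also covers the extreme point
   [(0, 1)], by exchanging the two summands. *)
Lemma Ts_le_extreme10 (R : realType) (Z X Y : normedModType R)
    (N : absNorm R) (Gamma : R)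
    (pi1 : {linear Z -> X}) (pi2 : {linear Z -> Y}) :
  (forall z, `|z| = N (`|pi1 z|, `|pi2 z|)) ->
  (forall x y, exists2 z, pi1 z = x & pi2 z = y) ->
  (exists x : X, x != 0) -> (exists y : Y, y != 0) ->
  0 < Gamma ->
  (forall a b : R, N (a, b) <= Gamma * Num.max `|a| `|b|) ->
  extreme_point [set v | N v <= 1] (1, 0) ->
  (Ts Z <= Gamma%:E)%E.
Proof.
move=> normE pi_surj [x x0] [y y0] G0 NG ext.
apply/lee_addgt0Pr => d d0; rewrite -EFinD.
(* Chosen so that [Gamma * (1 + e) = Gamma + d]. *)
pose e := d / Gamma; have e0 : 0 < e by rewrite divr_gt0.
have Ne := extreme10_absnorm_gt1 ext e0.
have norm_unit (V : normedModType R) (v : V) : v != 0 -> `| `|v|^-1 *: v| = 1.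
  by move=> v0; rewrite normrZ normfV normr_id mulVf// normr_eq0.
have [f [fle fx]] := norming_functional (`|x|^-1 *: x).
have [zx zx1 zx2] := pi_surj (`|x|^-1 *: x) 0.
have [zy zy1 zy2] := pi_surj 0 (`|y|^-1 *: y).
have pi1_le z : `|pi1 z| <= `|z| by rewrite normE absnorm_ge_l.
apply: ereal_inf_lbound; exists (Gamma + d) => //=.
split; first exact: addr_gt0.
(* With this width the slice condition reads [2 - N (1, e) < f (pi1 z)], the threshold of
   [absnorm_snd_lt]. *)
pose a := N (1, e) - 1; have a0 : 0 < a by rewrite subr_gt0.
exists zy, (slice (f \o pi1) a); split.
- by rewrite /unit_sphere/= normE zy1 zy2 normr0 norm_unit// absnorm01.
- exists (f \o pi1), a; split => //; apply: (@norming_dual_sphere _ _ _ zx).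
  + by move=> z /=; exact: le_trans (pi1_le z).
  + by rewrite normE zx1 zx2 normr0 norm_unit// absnorm10.
  + by rewrite /= zx1 fx norm_unit.
- move=> z [z1 /= fz]; rewrite closed_ballE ?addr_gt0//=.
  rewrite /unit_ball/= in z1.
  have fz1 := le_trans (ler_norm _) (fle (pi1 z)).
  have z2e : `|pi2 z| < e.
    apply: (@absnorm_snd_lt _ N e `|pi1 z|) => //; rewrite -?normE// ?ltW//.
    by move: fz fz1; rewrite /a; lra.
  rewrite /closed_ball_/= normE !linearB/= zy1 zy2 sub0r normrN.
  have y2 : `| `|y|^-1 *: y - pi2 z| <= 1 + e.
    by apply: le_trans (ler_normB _ _) _; rewrite norm_unit// lerD2l ltW.
  apply: (@le_trans _ _ (N (1, 1 + e))).
    by apply: absnorm_le => //; exact: le_trans (pi1_le z) z1.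
  apply: le_trans (NG _ _) _.
  have e1 : 1 <= 1 + e by rewrite lerDl ltW.
  rewrite normr1 ger0_norm; last exact: le_trans e1.
  by rewrite max_r// mulrDr mulr1 mulrCA mulfV ?gt_eqF// mulr1.
Qed.

(** * Absolute sums, exchange of summands and the l_p-norms *)

Section abs_sum_projections.
Context (R : realType) (N : absNorm R) (X Y : normedModType R).

Definition abs_sum_fst (z : abs_sum N X Y) : X := z.1.
Definition abs_sum_snd (z : abs_sum N X Y) : Y := z.2.

HB.instance Definition _ :=
  GRing.isLinear.Build R (abs_sum N X Y) X _ abs_sum_fst
    (fun _ _ _ => erefl).
HB.instance Definition _ :=
  GRing.isLinear.Build R (abs_sum N X Y) Y _ abs_sum_snd
    (fun _ _ _ => erefl).

End abs_sum_projections.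

Lemma extreme_point_swap (R : realType) (M N : absNorm R) (a b : R) :
  (forall c d, M (c, d) = N (d, c)) ->
  extreme_point [set v | N v <= 1] (b, a) ->
  extreme_point [set v | M v <= 1] (a, b).
Proof.
move=> MN [/= Nba ext]; split; first by rewrite /= MN.
move=> [u1 u2] [v1 v2] t /=; rewrite !MN => Nu Nv t01 [au bv].
have [|[-> ->] [-> ->]//] := ext (u2, u1) (v2, v1) t Nu Nv t01.
by rewrite au bv.
Qed.

Lemma lp_norm_le_max (R : realType) (p : R) (p1 : 1 <= p) (a b : R) :
  lp_norm p1 (a, b) <= 2 `^ p^-1 * Num.max `|a| `|b|.
Proof.
have p0 : 0 < p by exact: lt_le_trans p1.
have p0' := ltW p0.
set m := Num.max _ _; have m0 : 0 <= m by rewrite le_max normr_ge0.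
have mE : (m `^ p) `^ p^-1 = m by rewrite -powRrM mulfV ?gt_eqF// powRr1.
(* Writing [m] as the p-th root of [m]^ p[reduces the bound to]|a| [^ p + |b|]^ p <= 2 * m [^ p]. *)
rewrite /lp_norm /= /lp_fun /= -{1}mE -(powRM p^-1 (ler0n R 2) (powR_ge0 m p)).
apply: ge0_ler_powR; rewrite ?nnegrE ?invr_ge0 ?addr_ge0 ?mulr_ge0 ?powR_ge0//.
rewrite mulr_natl mulr2n lerD//;
  by apply: ge0_ler_powR; rewrite ?nnegrE// le_max lexx ?orbT.
Qed.

(** The two terms are at most [t] and [1 - t], which already add up to 1, so neither inequality can
    be strict. *)
Lemma convex_comb_eq1 (R : realType) (t u v : R) : 0 < t -> t < 1 ->
  u <= 1 -> v <= 1 -> t * u + (1 - t) * v = 1 -> u = 1 /\ v = 1.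
Proof.
move=> t0 t1 u1 v1 tuv.
have tu : t * u <= t by apply: ler_piMr => //; exact: ltW.
have tv : (1 - t) * v <= 1 - t by apply: ler_piMr => //; rewrite subr_ge0 ltW.
split.
- by apply: (mulfI (lt0r_neq0 t0)); rewrite mulr1; lra.
- have t1' : 0 < 1 - t by rewrite subr_gt0.
  by apply: (mulfI (lt0r_neq0 t1')); rewrite mulr1; lra.
Qed.

Lemma lp_norm_extreme10 (R : realType) (p : R) (p1 : 1 <= p) :
  extreme_point [set v | lp_norm p1 v <= 1] (1, 0).
Proof.
have p0 : 0 < p by exact: lt_le_trans p1.
split; first by rewrite /mkset absnorm10.
have fst_le1 a b : lp_norm p1 (a, b) <= 1 -> a <= 1.
  rewrite absnorm_abs; apply: le_trans.
  by apply: le_trans (ler_norm a) _; exact: absnorm_ge_l.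
have snd0 b : lp_norm p1 (1, b) <= 1 -> b = 0.
  rewrite /= /lp_fun/= normr1 powR1 => h.
  have : ((1 + `|b| `^ p) `^ p^-1) `^ p <= 1 `^ p.
    by apply: ge0_ler_powR h; rewrite ?nnegrE ?powR_ge0// ltW.
  rewrite -powRrM mulVf ?gt_eqF// powRr1 ?addr_ge0 ?powR_ge0// powR1.
  rewrite gerDl => b0; apply/normr0_eq0/(@powR_eq0_eq0 _ _ p)/le_anti.
  by rewrite b0 powR_ge0.
move=> [u1 u2] [v1 v2] t /= Nu Nv /andP[t0 t1] [] /=.
rewrite /GRing.scale/= => tuv _.
have u11 := fst_le1 _ _ Nu; have v11 := fst_le1 _ _ Nv.
have [u1E v1E] := convex_comb_eq1 t0 t1 u11 v11 (esym tuv).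
by move: Nu Nv; rewrite u1E v1E => /snd0 -> /snd0 ->.
Qed.

Theorem proposition2p4 (R : realType) (X Y : completeNormedModType R)
    (X_neq0 : exists x : X, x != 0) (Y_neq0 : exists y : Y, y != 0) :
  (forall (N : absNorm R) (Gamma : R), 0 < Gamma ->
     (forall a b : R, N (a, b) <= Gamma * Num.max `|a| `|b|) ->
     extreme_point [set v | N v <= 1] (1, 0) \/
     extreme_point [set v | N v <= 1] (0, 1) ->
     (Ts (abs_sum N X Y) <= Gamma%:E)%E) /\
  (forall (p : R) (p1 : 1 < p),
     (Ts (abs_sum (lp_norm (ltW p1)) X Y) <= (2 `^ p^-1)%:E)%E).
Proof.
have main10 (N : absNorm R) (Gamma : R) : 0 < Gamma ->
    (forall a b : R, N (a, b) <= Gamma * Num.max `|a| `|b|) ->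
    extreme_point [set v | N v <= 1] (1, 0) ->
    (Ts (abs_sum N X Y) <= Gamma%:E)%E.
  move=> G0 NG; apply: (@Ts_le_extreme10 _ (abs_sum N X Y) X Y N Gamma
    (@abs_sum_fst _ N X Y) (@abs_sum_snd _ N X Y)) => //.
  by move=> x y; exists ((x, y) : abs_sum N X Y).
split=> [N Gamma G0 NG [|ext01]|p p1]; first exact: main10.
(* Reading the same space with its coordinates exchanged and the swapped norm [M] turns the extreme
   point (0,1) into (1,0). *)
- have [M MN] := absnorm_swap N.
  apply: (@Ts_le_extreme10 _ (abs_sum N X Y) Y X M Gamma
    (@abs_sum_snd _ N X Y) (@abs_sum_fst _ N X Y)) => //.
  + by move=> y x; exists ((x, y) : abs_sum N X Y).
  + by move=> a b; rewrite MN maxC.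
  + exact: extreme_point_swap ext01.
- apply: main10; first exact: powR_gt0.
  + exact: lp_norm_le_max.
  + exact: lp_norm_extreme10.
Qed.
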